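(* For all integers $k\ge 1$ and $n\ge 1$, $\phi(k,n)=\Phi(k,n)-\Phi(k-1,n)$, where $\phi(k,n)$ is the number of isomorphism classes of (untwisted, multiplicity one) fission trees of slope $k$ with $n$ leaves, and $\Phi(k,n)$ is the number of isomorphism classes of (untwisted, multiplicity one) fission trees of slope $\le k$ with $n$ leaves.
   Context: An (untwisted, multiplicity one) fission tree is given by a sequence of nonempty finite sets and surjective maps $$J_1\twoheadrightarrow J_2\twoheadrightarrow J_3\twoheadrightarrow\cdots$$ with $|J_i|=1$ for all sufficiently large $i$. (Here $J_i$ is the set of nodes of height $i$ of the tree and the maps send a node to its parent; each node of $J_1$ has exactly one child, a leaf of height $0$, so the leaves are identified with $J_1$.) The number of leaves is $|J_1|$ and the slope is $\min\{i-1 : i\ge 1,\ |J_i|=1\}\ge 0$. An isomorphism between two fission trees is a family of bijections $J_i\to J_i'$ ($i\ge1$) commuting with the surjective maps. *)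

(* Defs.v *)
From HB Require Import structures.
From mathcomp Require Import all_boot all_order all_algebra.
From mathcomp Require Import boolp classical_sets.

Set Implicit Arguments.
Unset Strict Implicit.
Unset Printing Implicit Defensive.

(* Untwisted, multiplicity one fission trees. Indices are shifted by one:
   [node i] is the set J_(i+1) of nodes of height i+1. The leaves (height 0)
   are identified with their parents, so they are the elements of [node 0]. *)
Record fission_tree := FissionTree {
  node : nat -> finType;
  parent : forall i, node i -> node i.+1;
  node_nonempty : forall i, 0 < #|node i|;
  parent_surj : forall i (y : node i.+1), exists x : node i, parent x = y;
  node_eventually1 : exists N, forall i, N <= i -> #|node i| = 1
}.

Lemma node_ex1 (T : fission_tree) : exists i, #|node T i| == 1.
Proof. by have [N TN] := node_eventually1 T; exists N; rewrite TN. Qed.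

(* min {i - 1 : i >= 1, |J_i| = 1}; the shift of indices absorbs the -1. *)
Definition slope (T : fission_tree) : nat := ex_minn (node_ex1 T).

Definition nb_leaves (T : fission_tree) : nat := #|node T 0|.

Definition isomorphic (S T : fission_tree) : Prop :=
  exists f : forall i, node S i -> node T i,
    (forall i, bijective (f i)) /\
    (forall i (x : node S i), f i.+1 (parent x) = parent (f i x)).

(* Isomorphism classes are plain predicates: [set fission_tree] would be a
   universe inconsistency, as [fission_tree] quantifies over all finTypes. *)
Definition iso_classes (A : fission_tree -> Prop) : Type :=
  {C : fission_tree -> Prop | exists T, A T /\ C = isomorphic T}.

(* The number of isomorphism classes of trees satisfying A: the m such that
   these classes are in bijection with {0, ..., m-1}. The default value 0 for
   infinitely many classes plays no role below: finitely many trees with n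
   leaves have slope at most k, up to isomorphism. *)
Definition nb_iso_classes (A : fission_tree -> Prop) : nat :=
  xget 0 [set m | exists c : 'I_m -> iso_classes A, bijective c]%classic.

Definition phi (k n : nat) : nat :=
  nb_iso_classes (fun T => slope T = k /\ nb_leaves T = n).

Definition Phi (k n : nat) : nat :=
  nb_iso_classes (fun T => slope T <= k /\ nb_leaves T = n).

(* Main.v *)
Require Import Defs.
From mathcomp Require Import all_boot all_order all_algebra.
From mathcomp Require Import boolp.
From mathcomp Require classical_sets.

(** The trees of slope at most [k] with [n] leaves split into those of slope
    exactly [k] and those of slope at most [k - 1], and the slope is an
    isomorphism invariant, so the classes split accordingly. As the counting
    function has a junk value on infinite families, the content of the statement
    is the finiteness of the number of classes.

    Finiteness holds because a tree is determined by the equivalence relations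
    that its levels induce on the leaves (two leaves being related at level [i]
    when they have the same ancestor there), and those relations are trivial
    from the slope on ([isomorphic_from_leaves]). Numbering the leaves turns
    these relations into a [code] in a finite type; the set of the codes
    given by all numberings, [leaf_key], does not depend on a choice of
    numbering, hence is a complete isomorphism invariant with values in a finite
    type ([leaf_keyP]). The number of classes of a family is then the number
    of values of the invariant on it ([nb_iso_classesE]), and the theorem becomes
    the cardinality of a disjoint union of finite sets. *)

Set Implicit Arguments.
Unset Strict Implicit.
Unset Printing Implicit Defensive.

Lemma isomorphic_refl T : isomorphic T T.
Proof. by exists (fun i => id); split=> // i; exists id. Qed.

Lemma isomorphic_sym S T : isomorphic S T -> isomorphic T S.
Proof.
move=> [f [fbij fE]].
have fK i : {g | cancel (f i) g & cancel g (f i)}.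
  have finj := bij_inj (fbij i).
  have fsurj y : exists x, f i x == y.
    by have [g _ gK] := fbij i; exists (g y); rewrite gK.
  exists (fun y => xchoose (fsurj y)) => [x|y].
    by apply: finj; apply/eqP; exact: xchooseP (fsurj _).
  by apply/eqP; exact: xchooseP (fsurj y).
exists (fun i => s2val (fK i)); split=> [i|i y].
  by exists (f i); [exact: (s2valP' (fK i)) | exact: (s2valP (fK i))].
apply: (bij_inj (fbij i.+1)).
by rewrite (s2valP' (fK i.+1)) fE (s2valP' (fK i)).
Qed.

Lemma isomorphic_trans S T U :
  isomorphic S T -> isomorphic T U -> isomorphic S U.
Proof.
move=> [f [fbij fE]] [g [gbij gE]].
exists (fun i => g i \o f i); split=> [i|i x]; first exact: bij_comp.
by rewrite /= fE gE.
Qed.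

Lemma isomorphic_eq S T : isomorphic S T -> isomorphic S = isomorphic T.
Proof.
move=> ST; apply: funext => U; apply: propext; split.
  exact/isomorphic_trans/isomorphic_sym.
exact: isomorphic_trans.
Qed.

Lemma isomorphic_slope S T : isomorphic S T -> slope S = slope T.
Proof.
move=> [f [fbij _]].
have cardE i : #|node S i| = #|node T i| by exact: bij_eq_card (fbij i).
rewrite /slope; case: ex_minnP => m Sm minm; case: ex_minnP => p Tp minp.
by apply/eqP; rewrite eqn_leq minm ?minp ?cardE // -cardE.
Qed.

Lemma node_eq_above_slope T i (x y : node T i) : slope T <= i -> x = y.
Proof.
rewrite /slope; case: ex_minnP => m T1 _ le_mi.
rewrite -(subnKC le_mi) in x y *.
elim: (i - m) x y => [|j IHj].
  by rewrite addn0 => x y; apply: (fintype_le1P _); rewrite (eqP T1).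
rewrite addnS => x y; have [x' <-] := parent_surj x.
by have [y' <-] := parent_surj y; rewrite (IHj x' y').
Qed.

Fixpoint ancestor T i (x : node T 0) : node T i :=
  if i is j.+1 then parent (ancestor j x) else x.

Lemma ancestor_surj T i (y : node T i) : exists x, ancestor i x == y.
Proof.
elim: i y => [|i IHi] y; first by exists y.
have [z <-] := parent_surj y; have [x /eqP <-] := IHi z.
by exists x.
Qed.

Lemma morph_ancestor S T (f : forall i, node S i -> node T i) :
    (forall i (x : node S i), f i.+1 (parent x) = parent (f i x)) ->
  forall i x, f i (ancestor i x) = ancestor i (f 0 x).
Proof. by move=> fE; elim=> //= i IHi x; rewrite fE IHi. Qed.

(** The nodes at level [i] are the classes of leaves with the same ancestor at
    that level, so a bijection of the leaves that respects these relations
    descends to every level. *)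
Lemma isomorphic_from_leaves S T (g : node S 0 -> node T 0) :
    bijective g ->
    (forall i x y, (ancestor i x == ancestor i y) =
                   (ancestor i (g x) == ancestor i (g y))) ->
  isomorphic S T.
Proof.
move=> [g' gK g'K] gE.
pose f i (y : node S i) := ancestor i (g (xchoose (ancestor_surj y))).
have fE i x : f i (ancestor i x) = ancestor i (g x).
  by apply/eqP; rewrite -gE; apply: (xchooseP (ancestor_surj _)).
exists f; split=> [i|i y].
  pose h (z : node T i) := ancestor i (g' (xchoose (ancestor_surj z))).
  exists h => [y|z].
    have [x /eqP <-] := ancestor_surj y; rewrite fE; apply/eqP.
    by rewrite gE g'K (xchooseP (ancestor_surj _)).
  by rewrite fE g'K; apply/eqP; apply: (xchooseP (ancestor_surj z)).
have [x /eqP <-] := ancestor_surj y.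
by rewrite -[parent _]/(ancestor i.+1 x) !fE.
Qed.

Definition code k n T (b : 'I_n -> node T 0) : {set 'I_k * 'I_n * 'I_n} :=
  [set u : 'I_k * 'I_n * 'I_n |
    ancestor u.1.1 (b u.1.2) == ancestor u.1.1 (b u.2)].

(** Keeping the codes of all the numberings of the leaves, instead of choosing
    one, is what makes this an isomorphism invariant. *)
Definition leaf_key k n T : {set {set 'I_k * 'I_n * 'I_n}} :=
  [set X | `[< exists2 b : 'I_n -> node T 0, bijective b & X = code k b >]].

Lemma leaf_key_sub k n S T :
  isomorphic S T -> leaf_key k n S \subset leaf_key k n T.
Proof.
move=> [f [fbij fE]]; apply/subsetP => X; rewrite !inE.
move=> /asboolP[b bbij ->]; apply/asboolP; exists (f 0 \o b).
  exact: bij_comp.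
apply/setP => u; rewrite !inE /= -!(morph_ancestor fE).
by rewrite (inj_eq (bij_inj (fbij _))).
Qed.

(** A common code means that the leaves of both trees can be numbered so that
    levels below [k] induce the same relations on the numbers; from level [k] on
    there is a single node on both sides, so all leaves are related there. *)
Lemma leaf_keyP k n S T :
    slope S <= k /\ nb_leaves S = n -> slope T <= k /\ nb_leaves T = n ->
  leaf_key k n S = leaf_key k n T <-> isomorphic S T.
Proof.
move=> [Sk Sn] [Tk _]; split=> [keyE|ST]; last first.
  apply/eqP; rewrite eqEsubset !leaf_key_sub //; exact: isomorphic_sym.
have [b bbij] : exists b : 'I_n -> node S 0, bijective b.
  rewrite -Sn /nb_leaves; exists enum_val.
  exact: enum_val_bij.
have: code k b \in leaf_key k n S by rewrite inE; apply/asboolP; exists b.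
rewrite keyE inE => /asboolP[c cbij bcE].
have [b' bK b'K] := bbij.
apply: (@isomorphic_from_leaves _ _ (c \o b')).
  by apply: bij_comp => //; exists b.
move=> i x y; have [lt_ik|le_ki] := ltnP i k.
  have /setP/(_ (Ordinal lt_ik, b' x, b' y)) := bcE.
  by rewrite !inE /= !b'K.
have Seq : ancestor i x = ancestor i y.
  exact/node_eq_above_slope/(leq_trans Sk).
have Teq : ancestor i (c (b' x)) = ancestor i (c (b' y)).
  exact/node_eq_above_slope/(leq_trans Tk).
by rewrite /= Seq Teq !eqxx.
Qed.

Section Counting.
Variables (F : finType) (key : fission_tree -> F).

Definition keys_of (A : fission_tree -> Prop) : {set F} :=
  [set x | `[< exists2 T, A T & key T = x >]].

Lemma nb_iso_classes_bij A m (c : 'I_m -> iso_classes A) :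
  bijective c -> nb_iso_classes A = m.
Proof.
move=> cbij; rewrite /nb_iso_classes.
case: classical_sets.xgetP => [p _ [d dbij]|/(_ m) []].
  have [c' cK c'K] := cbij; have [d' dK d'K] := dbij.
  rewrite -(card_ord p) -(card_ord m).
  apply: (@bij_eq_card _ _ (c' \o d)).
  by apply: bij_comp => //; exists c.
by exists c.
Qed.

(** A complete isomorphism invariant with values in a finite type identifies
    the classes with its values, which in particular proves them finite in
    number. *)
Lemma nb_iso_classesE A :
    (forall S T, A S -> A T -> key S = key T <-> isomorphic S T) ->
  nb_iso_classes A = #|keys_of A|.
Proof.
move=> keyP.
have keys_val (i : 'I_#|keys_of A|) : exists2 T, A T & key T = enum_val i.
  by have := enum_valP i; rewrite inE => /asboolP.
(* The class is written in terms of its key alone, so that no representative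
   tree has to be chosen; the inverse map chooses an index in a finite type. *)
pose C (i : 'I_#|keys_of A|) T :=
  exists S, [/\ A S, key S = enum_val i & isomorphic S T].
have CE i T : A T -> key T = enum_val i -> C i = isomorphic T.
  move=> AT Ti; apply: funext => U; apply: propext; split=> [[S [AS Si SU]]|TU].
    by apply: isomorphic_trans SU; apply/keyP; rewrite // Ti Si.
  by exists T.
have Cclass i : exists T, A T /\ C i = isomorphic T.
  by have [T AT Ti] := keys_val i; exists T; split=> //; apply: CE.
have class_ex (D : iso_classes A) : exists i, `[< sval D = C i >].
  have [T [AT DE]] := svalP D.
  have kT : key T \in keys_of A by rewrite inE; apply/asboolP; exists T.
  exists (enum_rank_in kT (key T)); apply/asboolP.
  by rewrite DE (CE _ T) // enum_rankK_in.
pose c i : iso_classes A := exist _ (C i) (Cclass i).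
apply: (@nb_iso_classes_bij _ _ c); exists (fun D => xchoose (class_ex D)).
  move=> i; have /asboolP := xchooseP (class_ex (c i)).
  move: (xchoose _) => j /= Cij.
  have [S AS Si] := keys_val i; have [T AT Tj] := keys_val j.
  apply: enum_val_inj; rewrite -Si -Tj; apply/keyP => //.
  rewrite -(CE j T) // -Cij (CE i S) //; exact: isomorphic_refl.
move=> D; have /asboolP := xchooseP (class_ex D).
case: D (xchoose _) => D PD j /= DC; subst D; rewrite /c.
by congr exist; apply: Prop_irrelevance.
Qed.

End Counting.

Local Open Scope ring_scope.

(* The difference is taken in int, not with truncated subtraction on nat. *)
Theorem lemma3 (k n : nat) (hk : (1 <= k)%N) (hn : (1 <= n)%N) :
  (phi k n)%:Z = (Phi k n)%:Z - (Phi (k - 1) n)%:Z.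
Proof.
pose key := leaf_key k n.
pose bounded T := (slope T <= k)%N /\ nb_leaves T = n.
(* A single invariant, the one for slope at most [k], serves all three
   families, so that their sets of keys can be compared. *)
have count A : (forall T, A T -> bounded T) ->
    nb_iso_classes A = #|keys_of key A|.
  move=> Ab; apply: nb_iso_classesE => S T /Ab Sb /Ab Tb; exact: leaf_keyP.
have leb T : (slope T <= k - 1)%N = (slope T < k)%N by rewrite subn1 -ltnS prednK.
have eqb T : slope T = k /\ nb_leaves T = n -> bounded T.
  by rewrite /bounded => -[-> ->].
have ltb T : (slope T <= k - 1)%N /\ nb_leaves T = n -> bounded T.
  by rewrite leb => -[/ltnW].
rewrite /phi /Phi !count //.
set E := keys_of key _; set B := keys_of key _; set L := keys_of key _.
have -> : B = E :|: L.
  apply/setP => x; rewrite !inE; apply/asboolP/orP.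
    move=> [T [Tk Tn] Tx]; move: Tk; rewrite leq_eqVlt => /orP[/eqP Tk|Tk].
      by left; apply/asboolP; exists T.
    by right; apply/asboolP; exists T; rewrite ?leb.
  by case=> /asboolP[T AT Tx]; exists T => //; [exact: eqb | exact: ltb].
have EL0 : [disjoint E & L].
  rewrite disjoint_subset; apply/subsetP => x; rewrite !inE.
  move=> /asboolP[S AS Sx]; apply/asboolP => -[T AT Tx].
  have ST : isomorphic S T.
    by apply/(leaf_keyP (eqb _ AS) (ltb _ AT)); rewrite -/key Sx Tx.
  by case: AT AS; rewrite leb -(isomorphic_slope ST) => + _ [Sk _]; rewrite Sk ltnn.
by rewrite cardsU disjoint_setI0 // cards0 subn0 PoszD GRing.addrK.
Qed.
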